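(* There exist infinitely many positive integers $n$ such that for every integer $\ell$ with $3\leq \ell\leq \frac{n-1}{12\log n}+2$ we have $$M_{\mathcal{F}_{\ell}}(n)\geq 2^{n-2}.$$ In particular, this holds whenever $n\geq 64$ and $n=p$ or $n=2p-1$ for some odd prime $p$.
   Context: Logarithms are base 2. For graphs $G,G'$ on the same vertex set $[n]=\{1,\dots,n\}$, their symmetric difference $G\oplus G'$ is the graph on $[n]$ whose edge set consists of all edges belonging to exactly one of $G,G'$. For a class $\mathcal{F}$ of graphs, a family $\mathcal{G}$ of graphs on vertex set $[n]$ is $\mathcal{F}$-good if $G\oplus G'\in\mathcal{F}$ for every pair of distinct $G,G'\in\mathcal{G}$; $M_{\mathcal{F}}(n)$ denotes the maximum possible size of an $\mathcal{F}$-good family of graphs on $[n]$. $\mathcal{F}_{\ell}$ denotes the class of graphs containing a spanning tree with exactly $\ell$ leaves. *)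

(* Defs.v *)
From Stdlib Require Import Reals ClassicalEpsilon.
From mathcomp Require Import all_boot.

Set Implicit Arguments.
Unset Strict Implicit.
Unset Printing Implicit Defensive.

(* A (simple) graph on vertex set [n] (modelled as 'I_n) is given by its edge
   set: a set of 2-element subsets of 'I_n. *)
Definition graph_on (n : nat) := {set {set 'I_n}}.

Definition is_graph (n : nat) (G : graph_on n) : bool :=
  [forall e in G, #|e| == 2].

Definition adj (n : nat) (G : graph_on n) : rel 'I_n :=
  fun x y => [set x; y] \in G.

Definition symdiff (n : nat) (G G' : graph_on n) : graph_on n :=
  (G :\: G') :|: (G' :\: G).

Definition connected (n : nat) (G : graph_on n) : bool :=
  [forall x, forall y, connect (adj G) x y].

Definition has_cycle (n : nat) (G : graph_on n) : Prop :=
  exists c : seq 'I_n, [&& uniq c, 2 < size c & cycle (adj G) c].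

Definition spanning_tree (n : nat) (G T : graph_on n) : Prop :=
  [/\ is_graph T, T \subset G, connected T & ~ has_cycle T].

Definition degree (n : nat) (G : graph_on n) (v : 'I_n) : nat :=
  #|[set u | adj G v u]|.

Definition leaves (n : nat) (T : graph_on n) : {set 'I_n} :=
  [set v | degree T v == 1].

Definition in_F (l n : nat) (G : graph_on n) : Prop :=
  exists T : graph_on n, spanning_tree G T /\ #|leaves T| = l.

Definition good (F : forall n, graph_on n -> Prop) (n : nat)
    (Gs : {set graph_on n}) : Prop :=
  (forall G, G \in Gs -> is_graph G) /\
  (forall G G', G \in Gs -> G' \in Gs -> G != G' -> F n (symdiff G G')).

Definition asb (P : Prop) : bool :=
  if excluded_middle_informative P then true else false.

Definition M (F : forall n, graph_on n -> Prop) (n : nat) : nat :=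
  \max_(Gs : {set graph_on n} | asb (good F Gs)) #|Gs|.

Definition log2 (x : R) : R := Rdiv (ln x) (ln (INR 2)).

Definition thm_prop (n : nat) : Prop :=
  forall l : nat, 3 <= l ->
    Rle (INR l) (Rplus (Rdiv (Rminus (INR n) (INR 1)) (Rmult (INR 12) (log2 (INR n)))) (INR 2)) ->
    2 ^ (n - 2) <= M (in_F l) n.

(* Main.v *)
(* Let n be odd and let K_{n+1} have a perfect 1-factorization: n perfect
   matchings, any two of which form a Hamiltonian cycle.  Such factorizations
   are known for n = p (reflections of F_p, with one extra vertex) and for
   n = 2p - 1 (on two copies of F_p: reflections, and shifts between the
   copies).  Deleting a vertex leaves n colour classes on [n], any two of which
   form a Hamiltonian path.

   Reserve one colour class.  Words over the remaining n - 1 colours having even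
   weight form a linear code of size 2^(n-2); take the union of the selected
   colour classes, and let each reserved edge be selected by a parity check on
   one binary digit of the colours, the digits being spread evenly over the
   reserved edges.  A nonzero word then yields a Hamiltonian path from two of
   its colours together with a matching of about n / (2 log n) edges, taken
   from the reserved class or, when the word has weight at least 4, equal to a
   third colour class.  Rerouting the path along k suitably independent edges
   of this matching gives a spanning tree with exactly k + 2 leaves. *)

From Stdlib Require Import Reals Lra.
From mathcomp Require Import all_boot all_algebra zify.
Require Import Defs.

Set Implicit Arguments.
Unset Strict Implicit.
Unset Printing Implicit Defensive.

Import GRing.Theory.

(* [%R] is taken by [ring_scope]. *)
Delimit Scope R_scope with real.

(** * Trees obtained by rerouting a Hamiltonian path *)

Lemma set2_inj (T : finType) (x y a b : T) :
  [set x; y] = [set a; b] -> (x = a /\ y = b) \/ (x = b /\ y = a).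
Proof.
move=> E.
have /set2P xab : x \in [set a; b] by rewrite -E set21.
have /set2P yab : y \in [set a; b] by rewrite -E set22.
have /set2P axy : a \in [set x; y] by rewrite E set21.
have /set2P bxy : b \in [set x; y] by rewrite E set22.
by case: xab yab axy bxy => [] ? [] ? [] ? [] ?; subst; auto.
Qed.

Lemma odd_card_setDU (T : finType) (A B : {set T}) :
  odd #|(A :\: B) :|: (B :\: A)| = odd #|A| (+) odd #|B|.
Proof.
have disj : (A :\: B) :&: (B :\: A) = set0.
  by apply/setP => x; rewrite !inE; case: (x \in A); case: (x \in B).
rewrite cardsU disj cards0 subn0 oddD -(cardsID B A) -(cardsID A B) setIC.
by rewrite !oddD; case: (odd _); case: (odd _); case: (odd _).
Qed.

(** Each chosen element blocks itself and at most [d] others, so [k] choices block at most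
    [k * d.+1] elements and a larger [A] still offers a candidate. *)
Lemma greedy_independent (T : finType) (r : rel T) (d k : nat) (A : {set T}) :
  symmetric r -> (forall x, #|[set y in A | r x y]| <= d) ->
  k * d.+1 <= #|A| ->
  exists B : {set T}, [/\ B \subset A, #|B| = k
    & forall x y, x \in B -> y \in B -> x != y -> ~~ r x y].
Proof.
move=> rC degr; elim: k => [_|k IHk kA].
  by exists set0; rewrite sub0set cards0; split=> // x y; rewrite inE.
have [|B [BA cB indB]] := IHk; first by apply: leq_trans kA; rewrite leq_mul2r leqnSn orbT.
pose N := B :|: \bigcup_(x in B) [set y in A | r x y].
have cN : #|N| <= k * d.+1.
  rewrite mulnS -{1}cB; apply: leq_trans (leq_card_setU _ _) _.
  rewrite leq_add2l -cB -sum_nat_const.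
  apply: (big_rec2 (fun (X : {set T}) m => #|X| <= m)); first by rewrite cards0.
  move=> x m X _ le; apply: leq_trans (leq_card_setU _ _) _.
  exact: leq_add.
have : 0 < #|A :\: N|.
  have := cardsID N A; have : #|A :&: N| <= #|N| by rewrite subset_leq_card ?subsetIr.
  move=> h1 h2; rewrite -(ltn_add2l #|A :&: N|) h2 addn0.
  apply: leq_ltn_trans h1 _; apply: leq_ltn_trans cN _.
  by apply: leq_trans kA; rewrite ltn_mul2r ltnSn.
case/card_gt0P => z; rewrite !inE negb_or => /andP[/andP[zB zN] zA].
have nr x : x \in B -> ~~ r x z.
  move=> xB; apply: contra zN => rxz; apply/bigcupP; exists x => //.
  by rewrite inE zA.
exists (z |: B); split.
- by rewrite subUset sub1set zA.
- by rewrite cardsU1 zB cB.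
move=> x y; rewrite !inE => /orP[/eqP->|xB] /orP[/eqP->|yB] xy.
- by rewrite eqxx in xy.
- by rewrite rC nr.
- exact: nr.
- exact: indB.
Qed.

(** [x] and [par x] are positions, which [u] turns into vertices. The root is position [n], and the
    graph is a tree once parents have larger positions. *)
Definition parent_tree n (u par : 'I_n.+1 -> 'I_n.+1) : graph_on n.+1 :=
  [set [set u x; u (par x)] | x in [set x : 'I_n.+1 | x < n]].

Lemma adj_parent_tree n (u par : 'I_n.+1 -> 'I_n.+1) x y :
  injective u ->
  adj (parent_tree u par) (u x) (u y) =
  (x < n) && (par x == y) || (y < n) && (par y == x).
Proof.
move=> uI; apply/imsetP/orP => [[z]|[]/andP[lt /eqP <-]].
- rewrite inE => zn /set2_inj[[/uI -> /uI ->]|[/uI -> /uI ->]];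
  by rewrite zn eqxx; auto.
- by exists x; rewrite ?inE.
- by exists y; rewrite ?inE // setUC.
Qed.

Lemma adjC n (G : graph_on n) : symmetric (adj G).
Proof. by move=> x y; rewrite /adj setUC. Qed.

Lemma parent_tree_is_graph n (u par : 'I_n.+1 -> 'I_n.+1) :
  injective u -> (forall x : 'I_n.+1, x < n -> x < par x) ->
  is_graph (parent_tree u par).
Proof.
move=> uI par_gt; apply/forall_inP => e /imsetP[x]; rewrite inE => /par_gt lt ->.
by rewrite cards2 (inj_eq uI) -val_eqE /= (ltn_eqF lt).
Qed.

Lemma parent_tree_connected n (u par : 'I_n.+1 -> 'I_n.+1) :
  injective u -> (forall x : 'I_n.+1, x < n -> x < par x) ->
  connected (parent_tree u par).
Proof.
move=> uI par_gt; set T := parent_tree u par.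
have to_root m (x : 'I_n.+1) : n - x <= m -> connect (adj T) (u x) (u ord_max).
  elim: m x => [|m IHm] x lem.
    have -> // : x = ord_max.
    by apply/val_inj/eqP; rewrite /= eqn_leq -ltnS ltn_ord -subn_eq0 -leqn0.
  have [xn|xn] := ltnP x n; last first.
    have -> // : x = ord_max.
    by apply/val_inj/eqP; rewrite /= eqn_leq -ltnS ltn_ord.
  apply: connect_trans (IHm (par x) _).
    by apply: connect1; rewrite adj_parent_tree // xn eqxx.
  rewrite leq_subLR; rewrite leq_subLR addnS in lem.
  by apply: leq_trans lem _; rewrite -addSn leq_add2r; exact: par_gt.
apply/forallP => v; apply/forallP => w.
rewrite -(f_invF uI v) -(f_invF uI w).
apply: connect_trans (to_root n _ _) _; first exact: leq_subr.
rewrite (sym_connect_sym (@adjC _ T)).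
by apply: to_root; exact: leq_subr.
Qed.

(* On a cycle, the vertex of least position would have two neighbours of
   larger position, but its parent is the only such neighbour. *)
Lemma parent_tree_acyclic n (u par : 'I_n.+1 -> 'I_n.+1) :
  injective u -> (forall x : 'I_n.+1, x < n -> x < par x) ->
  ~ has_cycle (parent_tree u par).
Proof.
move=> uI par_gt [c /and3P[Uc szc cyc]].
have up (x y : 'I_n.+1) : x < y -> adj (parent_tree u par) (u x) (u y) -> y = par x.
  move=> xy; rewrite adj_parent_tree // => /orP[/andP[_ /eqP->]//|/andP[yn /eqP E]].
  by have := par_gt _ yn; rewrite E ltnNge ltnW.
pose pos := invF uI.
have [v0 v0c] : exists v, v \in c by case: c szc {Uc cyc} => // a *; exists a; rewrite mem_head.
case: (@arg_minnP _ v0 (mem c) (fun v => pos v : nat) v0c) => v vc minv.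
case: (rot_to vc) => i c' E.
move: Uc szc cyc; rewrite -(rot_uniq i) -(size_rot i) -(rot_cycle i) E.
have memc w : w \in c' -> w \in c by move=> wc'; rewrite -(mem_rot i) E inE wc' orbT.
case: c' memc {E} => [//|y c'] memc; case: (lastP c') memc => [//|c'' z] memc.
rewrite /= rcons_path last_rcons => /andP[vN /andP[yN _]] _ /andP[vy /andP[_ zv]].
have above w : w \in y :: rcons c'' z -> adj (parent_tree u par) v w -> pos w = par (pos v).
  move=> wc; rewrite -{1}(f_invF uI v) -{1}(f_invF uI w); apply: up.
  rewrite ltn_neqAle (minv w (memc w wc)) andbT val_eqE.
  apply: contra vN => /eqP/(congr1 u); rewrite !f_invF => E.
  by rewrite E.
have Ey := above y (mem_head _ _) vy.
have Ez : pos z = par (pos v).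
  by apply: above; rewrite 1?adjC // inE mem_rcons mem_head orbT.
move: yN; suff -> : y = z by rewrite mem_rcons mem_head.
by rewrite -(f_invF uI y) -(f_invF uI z) -/(pos y) -/(pos z) Ey Ez.
Qed.

Lemma card_leaves_relabel n (u : 'I_n -> 'I_n) (T : graph_on n) :
  injective u ->
  #|leaves T| = #|[set x | #|[set y | adj T (u x) (u y)]| == 1]|.
Proof.
move=> uI; rewrite -(card_preimset (leaves T) uI); apply: eq_card => x.
have E : u @^-1: [set y | adj T (u x) y] = [set y | adj T (u x) (u y)].
  by apply/setP => y; rewrite !inE.
by rewrite !inE -E (card_preimset _ uI).
Qed.

(* Along the path [u 0, ..., u n], moving the parent of each [a] in [A] from
   [a + 1] to [b a] turns exactly the vertices [a + 1] into new leaves. *)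
Lemma rerouted_path_tree n (u b : 'I_n.+1 -> 'I_n.+1) (A : {set 'I_n.+1})
    (G : graph_on n.+1) :
  0 < n -> injective u ->
  (forall x y : 'I_n.+1, y = x.+1 :> nat -> [set u x; u y] \in G) ->
  (forall a, a \in A -> [/\ a.+1 < b a, b a < n & [set u a; u (b a)] \in G]) ->
  (forall a a', a \in A -> a' \in A -> b a' != a.+1 :> nat) ->
  in_F (#|A| + 2) G.
Proof.
move=> n0 uI pathG AG indA.
pose par x := if x \in A then b x else inord x.+1.
have Sx (x : 'I_n.+1) : x < n -> (inord x.+1 : 'I_n.+1) = x.+1 :> nat.
  by move=> xn; rewrite inordK // ltnS.
have par_gt (x : 'I_n.+1) : x < n -> x < par x.
  move=> xn; rewrite /par; case: ifP => [/AG[lt _ _]|_]; first exact: ltnW.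
  by rewrite Sx.
exists (parent_tree u par); split.
  split; first exact: parent_tree_is_graph.
  - apply/subsetP => e /imsetP[x]; rewrite inE => xn ->; rewrite /par.
    by case: ifP => [/AG[]//|_]; apply: pathG; rewrite Sx.
  - exact: parent_tree_connected.
  - exact: parent_tree_acyclic.
have Alt a : a \in A -> a.+1 < n by move=> /AG[h1 h2 _]; apply: ltn_trans h2.
pose S := [set (inord a.+1 : 'I_n.+1) | a : 'I_n.+1 in A].
rewrite (card_leaves_relabel _ uI).
have -> : [set x | #|[set y | adj (parent_tree u par) (u x) (u y)]| == 1]
    = [set ord0; ord_max] :|: S.
  apply/setP => x; rewrite !inE.
  have nbr y : (y \in [set y | adj (parent_tree u par) (u x) (u y)]) =
      (x < n) && (par x == y) || (y < n) && (par y == x).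
    by rewrite inE adj_parent_tree.
  have single y : (forall z, (x < n) && (par x == z) || (z < n) && (par z == x) = (z == y)) ->
      #|[set y | adj (parent_tree u par) (u x) (u y)]| == 1.
    by move=> h; apply/cards1P; exists y; apply/setP => z; rewrite nbr h inE.
  have xle : x <= n by rewrite -ltnS.
  have [x0|x0] := eqVneq x ord0.
    rewrite (@single (par x)) // => z; rewrite x0 n0 /= eq_sym orbC.
    case: (boolP (_ && _)) => //= /andP[zn /eqP E].
    by have := par_gt _ zn; rewrite E.
  (* Since [b a < n], the last position keeps [n - 1] as its only child. *)
  have [xM|xM] := eqVneq x ord_max.
    rewrite (@single (inord n.-1)) // => z; rewrite xM /= ltnn /=.
    apply/andP/eqP => [[zn]|->]; last first.
      have h : (inord n.-1 : 'I_n.+1).+1 = n by rewrite inordK prednK // leqnSn.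
      rewrite h leqnn; split=> //; rewrite /par; case: ifP => [/Alt|_].
        by rewrite h ltnn.
      by rewrite -val_eqE /= Sx h.
    rewrite /par; case: ifP => [zA /eqP E|_ /eqP/(congr1 val) /=].
      by have [_] := AG _ zA; rewrite E /= ltnn.
    by rewrite Sx // => /(congr1 predn) /= <-; rewrite inord_val.
  have xn : x < n by rewrite ltn_neqAle xle andbT; apply: contra xM => /eqP E; apply/eqP/val_inj.
  have xp : 0 < x by rewrite lt0n; apply: contra x0 => /eqP E; apply/eqP/val_inj.
  rewrite /=; apply/idP/imsetP => [|[a aA E]]; last first.
    (* Position [a + 1] has lost its path predecessor, and [indA] keeps rerouted positions from
       landing on it, so only its parent remains. *)
    have xa : x = a.+1 :> nat by rewrite E Sx // ltnW // Alt.
    apply: (@single (par x)) => z; rewrite xn /= eq_sym orbC.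
    case: (boolP (_ && _)) => //= /andP[zn].
    rewrite /par; case: (boolP (z \in A)) => [zA|zA] /eqP E'.
      by have := indA _ _ aA zA; rewrite E' xa eqxx.
    have : z.+1 = a.+1 by rewrite -xa -E' Sx.
    by case=> /val_inj za; rewrite za aA in zA.
  have h : (inord x.-1 : 'I_n.+1) = x.-1 :> nat.
    by rewrite inordK // prednK // (leq_trans xle).
  have [pA|pA] := boolP ((inord x.-1 : 'I_n.+1) \in A).
    by exists (inord x.-1) => //; rewrite h prednK // inord_val.
  (* If [x - 1] was not rerouted, it is a second neighbour of [x] besides [par x]. *)
  case/cards1P=> y /setP E.
  have := E (par x); rewrite nbr xn eqxx inE => /esym/eqP e1.
  have := E (inord x.-1); rewrite nbr h prednK // xle /= /par (negbTE pA).
  rewrite h prednK // inord_val eqxx orbT inE => /esym/eqP e2.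
  have := par_gt _ xn; rewrite e1 -e2 h => lt.
  by have := leq_ltn_trans (leq_pred x) lt; rewrite ltnn.
rewrite cardsU (_ : _ :&: S = set0) ?cards0 ?subn0.
  have ne : ord0 != ord_max :> 'I_n.+1.
    by apply/negP => /eqP/(congr1 val) /= E; rewrite -E in n0.
  rewrite cards2 ne addnC card_in_imset //.
  move=> a a' aA a'A /(congr1 val) /=.
  rewrite (Sx a (ltnW (Alt _ aA))) (Sx a' (ltnW (Alt _ a'A))).
  by case=> /val_inj.
apply/setP => x; rewrite !inE; apply/negbTE/negP => /andP[xE /imsetP[a aA xa]].
have {}xa : x = a.+1 :> nat by rewrite xa Sx // ltnW // Alt.
case/orP: xE => /eqP E; rewrite E /= in xa; first by [].
by have := Alt _ aA; rewrite -xa ltnn.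
Qed.

(** * Perfect 1-factorizations *)

(* [s i] exchanges the ends of each edge of colour [i]; the last clause says
   that two colours form a connected graph, hence a Hamiltonian cycle. *)
Definition perfect_factorization (C V : finType) (s : C -> V -> V) : Prop :=
  [/\ forall i, involutive (s i),
      forall i x, s i x != x,
      forall i j x, s i x = s j x -> i = j
    & forall i j x (A : {set V}), i != j -> x \in A ->
        (forall y, y \in A -> (s i y \in A) && (s j y \in A)) -> A = setT].

(** Renaming along bijections carries the algebraic models over to colours ['I_n] and vertices
    [option 'I_n]. *)
Lemma perfect_factorization_transport (C V C' V' : finType) (s : C -> V -> V) :
  perfect_factorization s -> #|C'| = #|C| -> #|V'| = #|V| ->
  exists s' : C' -> V' -> V', perfect_factorization s'.
Proof.
move=> [sK sN sI sT] /esym eC /esym eV.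
pose f (i : C') : C := enum_val (cast_ord (esym eC) (enum_rank i)).
have fI : injective f by move=> i j /enum_val_inj/cast_ord_inj/enum_rank_inj.
pose g (x : V') : V := enum_val (cast_ord (esym eV) (enum_rank x)).
pose h (x : V) : V' := enum_val (cast_ord eV (enum_rank x)).
have gK : cancel g h by move=> x; rewrite /g /h enum_valK cast_ordKV enum_rankK.
have hK : cancel h g by move=> x; rewrite /g /h enum_valK cast_ordK enum_rankK.
have hI := can_inj hK.
exists (fun i x => h (s (f i) (g x))); split=> [i x|i x|i j x /hI/sI/fI //|i j x A ij xA clA].
- by rewrite hK sK gK.
- by rewrite (can2_eq hK gK) sN.
have gA y : (y \in g @: A) = (h y \in A).
  by apply/imsetP/idP => [[z zA ->]|hy]; [rewrite gK | exists (h y)].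
have E : g @: A = setT.
  apply: (sT (f i) (f j) (g x)); [by rewrite inj_eq | by rewrite gA gK|].
  by move=> y; rewrite !gA => /clA; rewrite hK.
by apply/setP => y; rewrite -{1}(gK y) -gA E !inE.
Qed.

Fixpoint alternating_walk (V : Type) (s t : V -> V) (x : V) (k : nat) : V :=
  if k is k'.+1 then
    (if odd k' then t else s) (alternating_walk s t x k')
  else x.

(* The first repetition along the walk can only be its starting point, reached
   through [t]; the vertices visited by then are closed under [s] and [t]. *)
Lemma alternating_walk_inj (V : finType) (s t : V -> V) (x : V) :
  involutive s -> involutive t -> (forall y, s y != y) -> (forall y, t y != y) ->
  (forall y, s y != t y) ->
  (forall A : {set V}, x \in A ->
     (forall y, y \in A -> (s y \in A) && (t y \in A)) -> A = setT) ->
  forall k l, k < #|V| -> l < #|V| ->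
    alternating_walk s t x k = alternating_walk s t x l -> k = l.
Proof.
move=> sK tK sN tN stN trans; set w := alternating_walk s t x.
pose st k := if odd k then t else s.
have wS k : w k.+1 = st k (w k) by [].
have stK k : involutive (st k) by rewrite /st; case: odd.
have stNN k y : st k y != y by rewrite /st; case: odd.
have stE k l y : st k y = st l y -> odd k = odd l.
  rewrite /st; case: (odd k); case: (odd l) => // /eqP.
    by rewrite eq_sym (negbTE (stN y)).
  by rewrite (negbTE (stN y)).
have inj m : m < #|V| -> forall k l, k <= m -> l <= m -> w k = w l -> k = l.
  elim: m => [|m IHm] mV; first by move=> k l; rewrite !leqn0 => /eqP-> /eqP->.
  have {}IHm := IHm (ltnW mV).
  have new l : l <= m -> w m.+1 <> w l.
    move=> lm E.
    have E' : w m = st m (w l) by rewrite -E wS stK.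
    case: l lm E E' => [|l] lm E E'.
      (* A return to [x] through [s] would give [w m = w 1], an earlier repetition or a fixed point
         of [s]. *)
      have om : odd m.
        apply: contraT => /negbTE om.
        have : w m = w 1 by rewrite E' /st om.
        case: m {mV lm E E'} om IHm => [|m] om IHm.
          by move/eqP; rewrite eq_sym (negbTE (stNN 0 x)).
        by move/IHm => /(_ (leqnn _) isT) [m0]; rewrite m0 in om.
      have E1 : w m = t x by rewrite E' /st om.
      have cl : [set w k | k : 'I_m.+1] = setT.
        apply: trans; first by apply/imsetP; exists ord0.
        have mem k : k <= m -> w k \in [set w k | k : 'I_m.+1].
          by move=> km; apply/imsetP; exists (inord k) => //; rewrite inordK.
        have memS k : k <= m -> st k (w k) \in [set w k | k : 'I_m.+1].
          rewrite leq_eqVlt => /orP[/eqP->|km]; first by rewrite -wS E mem.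
          by rewrite -wS mem.
        have memN k : k <= m -> st k.+1 (w k) \in [set w k | k : 'I_m.+1].
          case: k => [|k] km; first by rewrite /st /= -/w -E1 mem.
          have -> : st k.+2 = st k by rewrite /st /= negbK.
          by rewrite wS stK mem // ltnW.
        move=> y /imsetP[[k km] _ ->] /=.
        have := memS k km; have := memN k km.
        by rewrite /st /=; case: odd => /= -> ->.
      have := leq_imset_card (fun k : 'I_m.+1 => w k) 'I_m.+1.
      by rewrite cl cardsT card_ord leqNgt mV.
    (* The edge returning to [w l.+1] has the colour of step [l] or of step [l.+1], hence retraces
       it: [w m] is [w l] or [w l.+2]. Induction excludes both, except that [m = l.+1] gives a fixed
       point. *)
    have [om|om] := eqVneq (odd m) (odd l).
      have : w m = w l by rewrite E' wS (_ : st m = st l) ?stK // /st om.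
      by move/IHm => /(_ (leqnn _) (ltnW lm)) ml; rewrite ml ltnn in lm.
    have st_eq : st m = st l.+1 by rewrite /st /=; case: (odd m) (odd l) om => [] [].
    move: lm; rewrite leq_eqVlt => /orP[/eqP lm|lm].
      by move: E; rewrite wS lm; apply/eqP; exact: stNN.
    have : w m = w l.+2 by rewrite E' st_eq.
    move/IHm => /(_ (leqnn _) lm) ml; move: om; rewrite ml /=.
    by case: odd.
  move=> k l; rewrite leq_eqVlt => /orP[/eqP->|km]; rewrite leq_eqVlt => /orP[/eqP->|lm] //.
  - by move/new => /(_ lm).
  - by move/esym/new => /(_ km).
  - exact: IHm.
move=> k l kV lV; have [kl|/ltnW kl] := leqP k l; first exact: (inj l).
exact: (inj k).
Qed.

(** * Factorizations from reflections and shifts of $\mathbb{F}_p$ *)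

Lemma Fp_natr_onto (p : nat) (d x : 'F_p) :
  d != 0%R -> exists k : nat, x = (d *+ k)%R.
Proof.
move=> d0; exists (x / d : 'F_p)%R.
by rewrite -mulr_natr natr_Zp mulrC divfK.
Qed.

Lemma Fp_double_neq0 (p : nat) (x : 'F_p) :
  prime p -> odd p -> x != 0%R -> (x *+ 2)%R != 0%R.
Proof.
move=> pp po x0; rewrite -mulr_natr mulf_neq0 //.
rewrite -(dvdn_pcharf (pchar_Fp pp)).
by apply: contraTN po => /prime_nt_dvdP -> //; case: eqP pp => // ->.
Qed.

Lemma Fp_double_sub_eq (p : nat) (i x : 'F_p) : (i *+ 2 - x == i)%R = (x == i).
Proof. by rewrite mulr2n subr_eq (inj_eq (addrI _)) eq_sym. Qed.

(** Two reflections compose to the translation by [2(j - i)], which is nonzero for odd [p] and so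
    generates the additive group. *)
Lemma Fp_reflections_closed (p : nat) (i j x y : 'F_p) (B : pred 'F_p) :
  prime p -> odd p -> i != j ->
  (forall z, B z -> B (i *+ 2 - z)%R) -> (forall z, B z -> B (j *+ 2 - z)%R) ->
  B x -> B y.
Proof.
move=> pp po ij Bi Bj Bx.
have d0 : ((j - i) *+ 2)%R != 0%R :> 'F_p.
  by rewrite Fp_double_neq0 // subr_eq0 eq_sym.
have [k E] := Fp_natr_onto (y - x)%R d0.
have -> : y = (x + ((j - i) *+ 2) *+ k)%R by rewrite -E addrC subrK.
elim: k {E} => [|k IHk]; first by rewrite mulr0n addr0.
rewrite mulrS addrCA.
have shift (z : 'F_p) : ((j - i) *+ 2 + z)%R = (j *+ 2 - (i *+ 2 - z))%R.
  by rewrite mulrnBl opprB addrA addrAC.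
by rewrite shift; apply/Bj/Bi.
Qed.

(** For odd [p] the reflection about [i] fixes only [i], which is matched with the extra point
    [None]. *)
Lemma perfect_factorization_Fp (p : nat) : prime p -> odd p ->
  exists s : 'F_p -> option 'F_p -> option 'F_p, perfect_factorization s.
Proof.
move=> pp po.
pose s (i : 'F_p) (v : option 'F_p) :=
  if v is Some x then if x == i then None else Some (i *+ 2 - x)%R else Some i.
exists s; split=> [i [x|]|i [x|]|i j [x|]|i j v A ij vA clA] /=.
- by have [->|xi] := eqVneq x i; rewrite /= ?Fp_double_sub_eq ?(negbTE xi) ?subKr.
- by rewrite eqxx.
- have [//|xi] := eqVneq x i; apply/negP => /eqP/Some_inj/eqP.
  rewrite subr_eq -mulr2n -subr_eq0 -mulrnBl => E.
  by have := @Fp_double_neq0 _ (i - x)%R pp po; rewrite E subr_eq0 eq_sym xi => /(_ isT).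
- by [].
- have [xi|xi] := eqVneq x i; have [xj|xj] //= := eqVneq x j; first by rewrite -xi.
  move=> /Some_inj/addIr/eqP; rewrite -subr_eq0 -mulrnBl => E; apply/eqP.
  by rewrite -subr_eq0; apply: contraLR E; exact: Fp_double_neq0.
- by case.
have [x xA] : exists x, Some x \in A.
  by case: v vA => [x|] xA; [exists x | exists i; case/andP: (clA _ xA)].
have all y : Some y \in A.
  (* Colour [i] sends [i] to [None], but [i] is its own reflection, so [A] is still closed under the
     plain reflections. *)
  apply: (@Fp_reflections_closed p i j x y (fun z => Some z \in A)) => // z zA;
    have /andP[/= Ai Aj] := clA _ zA.
    by case: eqP Ai => [<- _|//]; rewrite mulr2n addrK.
  by case: eqP Aj => [<- _|//]; rewrite mulr2n addrK.
apply/setP => -[y|]; rewrite inE ?all //.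
by have /andP[] := clA _ (all i); rewrite /= eqxx.
Qed.

(** Complements of sets closed under involutions are closed, so a nonempty closed set cannot miss
    the base vertex; one start per pair of colours suffices. *)
Lemma perfect_factorization_generic_base (C V : finType) (s : C -> V -> V) :
  (forall i, involutive (s i)) ->
  (forall i j, i != j -> exists v, forall A : {set V}, v \in A ->
     (forall y, y \in A -> (s i y \in A) && (s j y \in A)) -> A = setT) ->
  forall i j x (A : {set V}), i != j -> x \in A ->
     (forall y, y \in A -> (s i y \in A) && (s j y \in A)) -> A = setT.
Proof.
move=> sK base i j x A ij xA clA; have [v vA] := base i j ij.
have [/vA|vNA] := boolP (v \in A); first exact.
have : ~: A = setT.
  apply: vA => [|y]; first by rewrite inE.
  rewrite !inE => yN; apply/andP.
  by split; apply: contra yN => /clA/andP[]; rewrite sK.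
by move/setP/(_ x); rewrite !inE xA.
Qed.

(** [inl i] reflects both copies of $\mathbb{F}_p$ about [i] and joins the two copies of [i];
    [inr d] shifts by [d] between the copies. The edges of shift [0] are those at the fixed points,
    whence [d != 0]. *)
Definition gk_involution (p : nat) (c : 'F_p + {d : 'F_p | d != 0%R})
    (v : 'F_p * bool) : 'F_p * bool :=
  match c with
  | inl i => if v.1 == i then (i, ~~ v.2) else ((i *+ 2 - v.1)%R, v.2)
  | inr d => if v.2 then ((v.1 - sval d)%R, false) else ((v.1 + sval d)%R, true)
  end.

Lemma gk_involutionK (p : nat) c : involutive (@gk_involution p c).
Proof.
case: c => [i|[d d0]] [x b] /=.
  have [->|xi] := eqVneq x i; rewrite /= ?eqxx ?negbK //.
  by rewrite Fp_double_sub_eq (negbTE xi) subKr.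
by case: b => /=; rewrite ?subrK ?addrK.
Qed.

Lemma perfect_factorization_Fp2 (p : nat) : prime p -> odd p ->
  perfect_factorization (@gk_involution p).
Proof.
move=> pp po.
have refl2 (x i : 'F_p) (b : bool) (A : {set 'F_p * bool}) :
    (forall y, y \in A -> gk_involution (inl i) y \in A) ->
    (x, b) \in A -> ((i *+ 2 - x)%R, b) \in A.
  move=> cl xA; have := cl _ xA; rewrite /=.
  by case: eqP => [xi _|//]; move: xA; rewrite xi mulr2n addrK.
split.
- exact: gk_involutionK.
- case=> [i|[d d0]] [x b] /=.
    have [->|xi] := eqVneq x i; rewrite xpair_eqE ?eqxx /=; first by case: b.
    rewrite andbT subr_eq -mulr2n -subr_eq0 -mulrnBl.
    by apply: Fp_double_neq0 => //; rewrite subr_eq0 eq_sym.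
  by case: b; rewrite xpair_eqE andbF.
- case=> [i|[d d0]] [j|[e e0]] [x b] /=.
  + have [xi|xi] := eqVneq x i; have [xj|xj] := eqVneq x j; first by rewrite -xi -xj.
    * by move/(congr1 snd); case: b.
    * by move/(congr1 snd); case: b.
    move/(congr1 fst) => /= /addIr/eqP; rewrite -subr_eq0 -mulrnBl => E.
    congr inl; apply/eqP; rewrite -subr_eq0.
    by apply: contraLR E; exact: Fp_double_neq0.
  + case: (eqVneq x i) => [->|_]; last by move/(congr1 snd); case: b.
    case: b => /(congr1 fst) /= /eqP.
      by rewrite eq_sym subr_eq addrC -subr_eq subrr eq_sym (negbTE e0).
    by rewrite addrC -subr_eq subrr eq_sym (negbTE e0).
  + case: (eqVneq x j) => [->|_]; last by move/(congr1 snd); case: b.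
    case: b => /(congr1 fst) /= /eqP.
      by rewrite subr_eq addrC -subr_eq subrr eq_sym (negbTE d0).
    by rewrite eq_sym addrC -subr_eq subrr eq_sym (negbTE d0).
  + move=> E; congr inr; apply: val_inj => /=; move: E.
    by case: b => /(congr1 fst) /= /addrI // /oppr_inj.
apply: perfect_factorization_generic_base; first exact: gk_involutionK.
(* From the fixed point [i], alternating the two colours reaches all [i ± kd], in a copy given by
   the parity of [k]. *)
have refl_shift (i : 'F_p) (d : {d : 'F_p | d != 0%R}) :
    exists v, forall A : {set 'F_p * bool}, v \in A ->
     (forall y, y \in A -> gk_involution (inl i) y \in A /\ gk_involution (inr d) y \in A) ->
     A = setT.
  exists (i, true) => A iA clA.
  have reach k : ((i + sval d *+ k)%R, ~~ odd k) \in A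
      /\ ((i - sval d *+ k)%R, ~~ odd k) \in A.
    elim: k => [|k [IH1 IH2]]; first by rewrite mulr0n addr0 subr0.
    have reflA x b : (x, b) \in A -> ((i *+ 2 - x)%R, b) \in A.
      by apply: refl2 => y /clA[].
    have E1 : ((i - sval d *+ k.+1) = i *+ 2 - (i + sval d *+ k.+1))%R.
      by rewrite mulr2n opprD addrACA subrr add0r.
    have E2 : ((i + sval d *+ k.+1) = i *+ 2 - (i - sval d *+ k.+1))%R.
      by rewrite mulr2n opprB addrACA subrr addr0.
    move: IH1 IH2; rewrite /=; case: (odd k) => /= IH1 IH2.
      have [_] := clA _ IH1; rewrite /= -addrA -mulrSr => h.
      by split=> //; rewrite E1; exact: reflA.
    have [_] := clA _ IH2; rewrite /= -addrA -opprD -mulrSr => h.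
    by split=> //; rewrite E2; exact: reflA.
  apply/setP => -[x b]; rewrite inE.
  have [k E] := Fp_natr_onto (x - i)%R (valP d).
  have Ex : x = (i + sval d *+ k)%R by rewrite -E addrC subrK.
  (* As [p] is odd, replacing [k] by [k + p] keeps the element but switches the copy. *)
  have Ep : x = (i + sval d *+ (k + p))%R.
    by rewrite mulrnDr addrA -Ex -mulr_natr pchar_Fp_0 // mulr0 addr0.
  have [kb|kb] := eqVneq (~~ odd k) b.
    by rewrite -kb Ex; case: (reach k).
  have -> : b = ~~ odd (k + p) by rewrite oddD po; case: (odd k) b kb => [] [].
  by rewrite Ep; case: (reach (k + p)).
case=> [i|d] [j|e] ij.
(* Two reflections fill each copy, and the edge at [i] links the copies. *)
- exists (i, true) => A iA clA.
  have clAi y : y \in A -> gk_involution (inl i) y \in A by move=> /clA/andP[].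
  have clAj y : y \in A -> gk_involution (inl j) y \in A by move=> /clA/andP[].
  have layer x y b : (x, b) \in A -> (y, b) \in A.
    apply: (@Fp_reflections_closed p i j x y (fun z => (z, b) \in A)) => // z.
      exact: refl2.
    exact: refl2.
  apply/setP => -[x [|]]; rewrite inE; first exact: layer iA.
  by apply: (layer i); have := clAi _ iA; rewrite /= eqxx.
- have [v vP] := refl_shift i e; exists v => A vA clA.
  by apply: vP => // y /clA/andP[].
- have [v vP] := refl_shift j d; exists v => A vA clA.
  by apply: vP => // y /clA/andP[].
(* Shifting forward by [d] and back by [e] translates a copy by the nonzero [d - e]. *)
exists (0%R, false) => A oA clA.
have de : (sval d - sval e)%R != 0%R.
  by rewrite subr_eq0; apply: contra ij => /eqP/val_inj ->.
have layer0 x : (x, false) \in A.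
  have [k ->] := Fp_natr_onto x de.
  elim: k => [|k IHk] //; rewrite mulrSr addrA.
  have /andP[h _] := clA _ IHk.
  by have /andP[_] := clA _ h.
apply/setP => -[x [|]]; rewrite inE ?layer0 //.
by have /andP[] := clA _ (layer0 (x - sval d)%R); rewrite /= subrK.
Qed.

(** * Two colours and a matching *)

(* [None] is the deleted vertex: the class of colour [i] misses its partner. *)
Definition factor n (s : 'I_n -> option 'I_n -> option 'I_n) (i : 'I_n) : graph_on n :=
  [set e | [exists x, exists y, (e == [set x; y]) && (s i (Some x) == Some y)]].

Section Factors.
Variables (n : nat) (s : 'I_n -> option 'I_n -> option 'I_n).
Hypothesis perfect_s : perfect_factorization s.

Lemma factorP i e :
  reflect (exists x y, e = [set x; y] /\ s i (Some x) = Some y) (e \in factor s i).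
Proof.
rewrite inE; apply: (iffP existsP) => [[x /existsP[y /andP[/eqP-> /eqP E]]]|[x [y [-> E]]]].
  by exists x, y.
by exists x; apply/existsP; exists y; rewrite E !eqxx.
Qed.

Lemma factor_set2 i x y : ([set x; y] \in factor s i) = (s i (Some x) == Some y).
Proof.
have [sK _ _ _] := perfect_s.
apply/factorP/eqP => [[x' [y' [/set2_inj[[-> ->]|[-> ->]] E]]]|E] //.
  by rewrite -E sK.
by exists x, y.
Qed.

Lemma factor_inj i j e : e \in factor s i -> e \in factor s j -> i = j.
Proof.
have [_ _ sI _] := perfect_s.
case/factorP => x [y [-> E]]; rewrite factor_set2 => /eqP; rewrite -E => /esym.
exact: sI.
Qed.

Lemma card_factor_edge i e : e \in factor s i -> #|e| = 2.
Proof.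
have [_ sN _ _] := perfect_s.
case/factorP => x [y [-> E]]; rewrite cards2.
by have := sN i (Some x); rewrite E (inj_eq Some_inj) eq_sym => ->.
Qed.

(** The edges cover every vertex except the partner of [None], two vertices each. *)
Lemma card_factor i : n.-1 <= 2 * #|factor s i|.
Proof.
have [sK _ _ _] := perfect_s.
have cov : [set x | s i (Some x) != None] \subset cover (factor s i).
  apply/subsetP => x; rewrite inE; case E: (s i (Some x)) => [y|] // _.
  apply/bigcupP; exists [set x; y]; last exact: set21.
  by rewrite factor_set2 E.
have : #|cover (factor s i)| <= 2 * #|factor s i|.
  apply: leq_trans (leq_card_cover _) _.
  rewrite mulnC -sum_nat_const; apply: leq_sum => e ei.
  by rewrite (card_factor_edge ei).
apply: leq_trans; apply: leq_trans (subset_leq_card cov).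
have -> : [set x | s i (Some x) != None] = ~: [set x | s i (Some x) == None].
  by apply/setP => x; rewrite !inE.
rewrite cardsCs setCK card_ord -subn1 leq_sub2l //.
rewrite -(cards1 (s i None)) -(card_imset _ (@Some_inj _)); apply: subset_leq_card.
apply/subsetP => _ /imsetP[x + ->]; rewrite !inE => /eqP E.
by rewrite -E sK.
Qed.
End Factors.

(* The alternating walk of colours [i] and [j] starting at the extra vertex
   [None] is a Hamiltonian path after deletion of its starting point. *)
Lemma two_factors_hamiltonian n (s : 'I_n.+1 -> option 'I_n.+1 -> option 'I_n.+1) i j :
  perfect_factorization s -> i != j ->
  exists u : 'I_n.+1 -> 'I_n.+1, injective u /\
    forall x y : 'I_n.+1, y = x.+1 :> nat ->
      [set u x; u y] \in factor s i :|: factor s j.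
Proof.
move=> perf ij; have [sK sN sI sT] := perf.
pose w := alternating_walk (s i) (s j) None.
have wI k l : k <= n.+1 -> l <= n.+1 -> w k = w l -> k = l.
  move=> kn ln; apply: alternating_walk_inj; rewrite ?card_option ?card_ord //.
  - by move=> y; apply: contra ij => /eqP/sI->.
  - by move=> A xA clA; apply: (sT i j None).
have wSome (k : 'I_n.+1) : exists v, w k.+1 = Some v.
  case E: (w k.+1) => [v|]; first by exists v.
  by have := wI k.+1 0 (ltn_ord k) isT E.
(* The walk avoids [None] at steps 1 to [n.+1], so the default is never taken; the shift by one
   drops the deleted vertex. *)
pose u (k : 'I_n.+1) := odflt ord0 (w k.+1).
have uE (k : 'I_n.+1) : w k.+1 = Some (u k) by rewrite /u; have [v ->] := wSome k.
exists u; split=> [x y E|x y yx].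
  have : w x.+1 = w y.+1 by rewrite !uE E.
  by move/(wI _ _ (ltn_ord x) (ltn_ord y)) => [/val_inj].
rewrite inE !factor_set2 // -!uE yx.
have wS k : w k.+1 = (if odd k then s j else s i) (w k) by [].
by rewrite (wS x.+1); case: (odd x.+1); rewrite eqxx ?orbT.
Qed.

(** Each rerouting edge conflicts with at most two others, so a third of them can be kept; the
    strict inequality pays for one edge lost at the end of the path. *)
Lemma hamiltonian_plus_matching n
    (s : 'I_n.+1 -> option 'I_n.+1 -> option 'I_n.+1) i j c (D G : graph_on n.+1) k :
  0 < n -> perfect_factorization s -> i != j -> c != i -> c != j ->
  factor s i \subset G -> factor s j \subset G -> D \subset factor s c ->
  D \subset G -> k * 3 < #|D| -> in_F (k + 2) G.
Proof.
move=> n0 perf ij ci cj iG jG Dc DG kD.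
have [u [uI pathu]] := two_factors_hamiltonian perf ij.
have [sK sN sI _] := perf.
pose pos := invF uI.
(* [b x] is the position matched to [x] by colour [c]. The default [x] is filtered out by [x < b x]
   in [A0], which records each edge of [D] by its lower end. *)
pose b x := if s c (Some (u x)) is Some v then pos v else x.
have bE x y : [set u x; u y] \in factor s c -> b x = y.
  by rewrite factor_set2 // /b => /eqP->; rewrite /pos invF_f.
pose A0 := [set x : 'I_n.+1 | (x < b x) && ([set u x; u (b x)] \in D)].
have bI x y : x \in A0 -> y \in A0 -> b x = b y -> x = y.
  rewrite !inE => /andP[_ /(subsetP Dc)xD] /andP[_ /(subsetP Dc)yD] E.
  by rewrite setUC in xD; rewrite setUC in yD; rewrite -(bE _ _ xD) -(bE _ _ yD) E.
have DA0 : #|D| <= #|A0|.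
  have sub : D \subset [set [set u x; u (b x)] | x in A0].
    apply/subsetP => e eD; have /factorP[v [v' [E sv]]] := subsetP Dc _ eD.
    have [x vE] : exists x, v = u x by exists (pos v); rewrite f_invF.
    have [x' vE'] : exists x, v' = u x by exists (pos v'); rewrite f_invF.
    subst e v v'.
    have Dx := bE _ _ (subsetP Dc _ eD).
    have eD' := eD; rewrite setUC in eD'.
    have Dx' := bE _ _ (subsetP Dc _ eD').
    case: (ltngtP x x') => [lt|lt|/val_inj xx'].
    - by apply/imsetP; exists x; rewrite ?inE Dx ?lt ?eD.
    - by apply/imsetP; exists x'; rewrite ?inE Dx' ?lt ?eD' // setUC.
    - have := card_factor_edge perf (subsetP Dc _ eD).
      by rewrite xx' setUid cards1.
  by apply: leq_trans (subset_leq_card sub) (leq_imset_card _ _).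
(* The last position must stay a leaf, and at most one matching edge ends there. *)
pose A1 := [set x in A0 | b x < n].
have A01 : #|A0| <= #|A1|.+1.
  rewrite -(cardsID [set x : 'I_n.+1 | b x < n] A0) -[#|A1|.+1]addn1; apply: leq_add.
    by apply: subset_leq_card; apply/subsetP => x; rewrite !inE.
  apply/card_le1_eqP => x y; rewrite !inE -!leqNgt.
  move=> /andP[xn xA] /andP[yn yA]; apply: bI; rewrite ?inE //.
  have top (z : 'I_n.+1) : n <= z -> z = n :> nat.
    by move=> nz; apply/eqP; rewrite eqn_leq nz -ltnS ltn_ord.
  by apply/val_inj; rewrite /= (top _ xn) (top _ yn).
(* Conflict: one edge lands on the new leaf created by the other. Injectivity of [b] allows at most
   one conflict in each direction. *)
pose r (x y : 'I_n.+1) := (b y == x.+1 :> nat) || (b x == y.+1 :> nat).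
have rC : symmetric r by move=> x y; rewrite /r orbC.
have rdeg x : #|[set y in A1 | r x y]| <= 2.
  have -> : [set y in A1 | r x y] =
     [set y in A1 | b y == x.+1 :> nat] :|: [set y in A1 | b x == y.+1 :> nat].
    by apply/setP => y; rewrite !inE /r andb_orr.
  apply: leq_trans (leq_card_setU _ _) _; rewrite -[2]/(1 + 1); apply: leq_add.
    apply/card_le1_eqP => y z; rewrite !inE => /andP[/andP[yA _] /eqP E] /andP[/andP[zA _] /eqP E'].
    by apply: bI; rewrite ?inE //; apply/val_inj; exact: etrans E' (esym E).
  apply/card_le1_eqP => y z; rewrite !inE => /andP[_ /eqP E] /andP[_ /eqP E'].
  by apply/val_inj/succn_inj; rewrite -[LHS]E' -[RHS]E.
have kA1 : k * 3 <= #|A1| by rewrite -ltnS; apply: leq_trans A01; apply: leq_trans DA0.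
have [A [AA1 <- indA]] := greedy_independent rC rdeg kA1.
have bNS x : x \in A1 -> b x != x.+1 :> nat.
  rewrite !inE => /andP[/andP[_ xD] _]; apply/negP => /eqP /pathu.
  by rewrite inE => /orP[] /(factor_inj perf (subsetP Dc _ xD)) E; rewrite E eqxx in ci cj.
apply: (@rerouted_path_tree n u b) => //.
- move=> x y /pathu; rewrite inE => /orP[]; exact: subsetP.
- move=> a /(subsetP AA1) aA; have aN := bNS _ aA.
  move: aA; rewrite !inE => /andP[/andP[lt aD] ltn].
  by split=> //; [rewrite ltn_neqAle eq_sym aN | exact: subsetP aD].
move=> a a' aA a'A; have [->|aa'] := eqVneq a a'.
  exact/bNS/(subsetP AA1).
by have := indA _ _ aA a'A aa'; rewrite /r negb_or => /andP[].
Qed.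

(** * The code *)

(** The floor of the logarithm is at most its real value, so the bound on [l] survives clearing
    denominators. *)
Lemma trunc_log2_bound (n l : nat) :
  1 < n -> 2 <= l ->
  Rle (INR l) (Rplus (Rdiv (Rminus (INR n) (INR 1)) (Rmult (INR 12) (log2 (INR n)))) (INR 2)) ->
  12 * (l - 2) * trunc_log 2 n <= n.-1.
Proof.
move=> n1 l2 lb; set L := trunc_log 2 n.
have Ln : 2 ^ L <= n by apply: trunc_logP => //; exact: ltnW.
have L1 : 0 < L by rewrite trunc_log_gt0.
have ln2 : (0 < ln (INR 2))%real by rewrite -ln_1; apply: ln_increasing; simpl; lra.
have powE m : INR (2 ^ m) = (INR 2 ^ m)%real.
  by elim: m => [|m IHm] //; rewrite expnS mult_INR IHm.
have Llog : (INR L <= log2 (INR n))%real.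
  rewrite /log2; apply: (Rmult_le_reg_r (ln (INR 2))) => //.
  rewrite /Rdiv Rmult_assoc Rinv_l ?Rmult_1_r; last lra.
  rewrite -ln_pow; last by simpl; lra.
  rewrite -powE; have [->|lt] := eqVneq (2 ^ L) n; first exact: Rle_refl.
  apply/Rlt_le/ln_increasing; first by apply: lt_0_INR; apply/ltP; rewrite expn_gt0.
  by apply/lt_INR/ltP; rewrite ltn_neqAle lt.
have Lpos : (0 < INR L)%real by apply: lt_0_INR; apply/ltP.
have lE : INR (l - 2) = (INR l - INR 2)%real by rewrite minus_INR //; apply/leP.
have nE : INR n.-1 = (INR n - INR 1)%real by rewrite -subn1 minus_INR //; apply/leP; exact: ltnW.
have k0 : (0 <= INR (l - 2))%real by exact: pos_INR.
apply/leP/INR_le; rewrite -!multE !mult_INR nE.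
set y := log2 (INR n) in lb Llog *.
have y12 : (0 < INR 12 * y)%real by apply: Rmult_lt_0_compat; [apply: lt_0_INR; apply/ltP | lra].
have {}lb : (INR (l - 2) <= (INR n - INR 1) / (INR 12 * y))%real by lra.
have := Rmult_le_compat_r _ _ _ (Rlt_le _ _ y12) lb.
rewrite /Rdiv Rmult_assoc Rinv_l ?Rmult_1_r; last lra.
apply: Rle_trans; rewrite -Rmult_assoc (Rmult_comm (INR 12)).
apply: Rmult_le_compat_l => //; apply: Rmult_le_pos => //; exact: pos_INR.
Qed.

(** * Binary digits and the even spreading of checks *)

Definition digit (a t : nat) : bool := odd (a %/ 2 ^ t).

Lemma digits_inj (K a b : nat) :
  a < 2 ^ K -> b < 2 ^ K -> (forall t, t < K -> digit a t = digit b t) -> a = b.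
Proof.
elim: K a b => [|K IHK] a b; first by rewrite expn0 !ltnS !leqn0 => /eqP-> /eqP->.
rewrite expnS mulnC => aK bK ab.
rewrite (divn_eq a 2) (divn_eq b 2) !modn2.
have -> : odd a = odd b by have := ab 0 isT; rewrite /digit expn0 !divn1.
congr (_ * _ + _); apply: IHK; rewrite ?ltn_divLR // => t tK.
by have := ab t.+1 tK; rewrite /digit expnS !divnMA.
Qed.

Lemma digits_neq (K a b : nat) :
  a < 2 ^ K -> b < 2 ^ K -> a != b -> exists2 t, t < K & digit a t != digit b t.
Proof.
move=> aK bK ab.
have [/existsP[t tab]|/existsPn same] := boolP [exists t : 'I_K, digit a t != digit b t].
  by exists t.
case/eqP: ab; apply: (digits_inj aK bK) => t tK.
by have /negPn/eqP := same (Ordinal tK).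
Qed.

(** Every full block of [K] consecutive indices contains one of residue [t]. *)
Lemma card_index_class (T : finType) (E : {set T}) (K t : nat) :
  t < K -> #|E| %/ K <= #|[set e in E | index e (enum E) %% K == t]|.
Proof.
move=> tK; set q := #|E| %/ K; set N := [set _ in _ | _].
have [E0|[e0 _]] := set_0Vmem E; first by rewrite /q E0 cards0 div0n.
pose f (i : 'I_q) := nth e0 (enum E) (i * K + t).
have lt (i : 'I_q) : i * K + t < size (enum E).
  rewrite -cardE; apply: leq_trans (leq_trunc_div #|E| K).
  by apply: (@leq_trans (i.+1 * K)); [rewrite mulSn addnC ltn_add2r | rewrite leq_mul2r ltn_ord orbT].
have idx (i : 'I_q) : index (f i) (enum E) = i * K + t by rewrite index_uniq ?enum_uniq.
have fI : injective f.
  move=> i j /(congr1 (index^~ (enum E))); rewrite !idx => /addIn/eqP.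
  by rewrite eqn_pmul2r ?(leq_ltn_trans _ tK) // => /eqP/val_inj.
rewrite -[q in q <= _]card_ord -(card_imset _ fI); apply: subset_leq_card.
apply/subsetP => _ /imsetP[i _ ->]; rewrite inE -mem_enum mem_nth //=.
by rewrite idx modnMDl modn_small.
Qed.

Lemma leq_M (F : forall n, graph_on n -> Prop) n (Gs : {set graph_on n}) :
  good F Gs -> #|Gs| <= M F n.
Proof.
move=> gd; apply: (@leq_bigmax_cond _ (fun Gs => asb (good F Gs)) (fun Gs => #|Gs|)).
by rewrite /asb; case: ClassicalEpsilon.excluded_middle_informative.
Qed.

(** The encoder of a linear code over $\mathbb{F}_2$: coordinate [e] is the parity of the word [T]
    on the support [R e]. *)
Definition codeword_graph n (R : {set 'I_n} -> {set 'I_n}) (T : {set 'I_n}) : graph_on n :=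
  [set e : {set 'I_n} | (#|e| == 2) && odd #|T :&: R e|].

Lemma symdiff_codeword_graph n (R : {set 'I_n} -> {set 'I_n}) (S T : {set 'I_n}) :
  symdiff (codeword_graph R S) (codeword_graph R T) =
  codeword_graph R ((S :\: T) :|: (T :\: S)).
Proof.
apply/setP => e; rewrite !inE.
have -> : ((S :\: T) :|: (T :\: S)) :&: R e =
    ((S :&: R e) :\: (T :&: R e)) :|: ((T :&: R e) :\: (S :&: R e)).
  apply/setP => a; rewrite !inE.
  by case: (a \in S); case: (a \in T); case: (a \in R e).
rewrite odd_card_setDU.
by case: (#|e| == 2); case: (odd _); case: (odd _).
Qed.

(** By linearity the difference of two codewords is a nonzero codeword. As the empty graph is not in
    [F], distinct words also give distinct graphs. *)
Lemma linear_code_leq_M n (F : forall n, graph_on n -> Prop)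
    (R : {set 'I_n} -> {set 'I_n}) (C : {set 'I_n}) :
  ~ F n set0 ->
  (forall T : {set 'I_n}, T \subset C -> T != set0 -> F n (codeword_graph R T)) ->
  2 ^ #|C| <= M F n.
Proof.
move=> F0 FT; pose g := codeword_graph R.
have diffF (S T : {set 'I_n}) : S \subset C -> T \subset C -> S != T -> F n (symdiff (g S) (g T)).
  move=> SC TC ST; rewrite symdiff_codeword_graph; apply: FT.
    by rewrite subUset !(subset_trans (subsetDl _ _)).
  apply: contra ST; rewrite setU_eq0 !setD_eq0 => /andP[h1 h2].
  by rewrite eqEsubset h1.
rewrite -card_powerset -(card_in_imset (f := g)).
  apply: leq_M; split=> [_ /imsetP[T _ ->]|_ _ /imsetP[S SC ->] /imsetP[T TC ->] ST].
    by apply/forall_inP => e; rewrite inE => /andP[].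
  rewrite !powersetE in SC TC; apply: diffF => //.
  by apply: contra ST => /eqP->.
move=> S T; rewrite !powersetE => SC TC gST; apply/eqP; apply: contra_notT F0.
by move=> /(diffF _ _ SC TC); rewrite gST /symdiff setDv setU0.
Qed.

Lemma in_F_set0 (l n : nat) : ~ in_F l (set0 : graph_on n.+2).
Proof.
case=> T [[_ T0 conn _] _].
have /connectP[p] := forallP (forallP conn ord0) ord_max.
case: p => [|v p] /=; first by move=> _ /eqP.
by move=> /andP[/(subsetP T0)]; rewrite inE.
Qed.

(* Colours strictly between [0] and [n] are free bits.  Colour [0] is a parity
   check, and an edge of colour [n] checks one binary digit of the colours, so
   that any one or two colours select a whole class of edges of colour [n]. *)
Definition checks n (s : 'I_n.+1 -> option 'I_n.+1 -> option 'I_n.+1) (K : nat)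
    (e : {set 'I_n.+1}) : {set 'I_n.+1} :=
  if e \in factor s ord0 then setT
  else if e \in factor s ord_max then
    [set a : 'I_n.+1 | digit a (index e (enum (factor s ord_max)) %% K)]
  else [set a | e \in factor s a].

(** A class has at least [n / 2] edges, so each of its [K] parts has the [3k + 1] edges needed for
    rerouting; [n < 2 ^ K] lets [K] digits separate the colours. *)
Lemma codeword_graph_in_F n (s : 'I_n.+1 -> option 'I_n.+1 -> option 'I_n.+1)
    (K k : nat) (T : {set 'I_n.+1}) :
  perfect_factorization s -> n < 2 ^ K -> 0 < K -> K * (k * 3).+1 * 2 <= n ->
  T \subset [set a : 'I_n.+1 | 0 < a < n] -> T != set0 ->
  in_F (k + 2) (codeword_graph (checks s K) T).
Proof.
move=> perf nK K0 kK TC T0; set G := codeword_graph _ _.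
have n0 : 0 < n by apply: leq_trans kK; rewrite !muln_gt0 K0.
have cardD c : K * (k * 3).+1 <= #|factor s c|.
  by rewrite -(leq_pmul2l (isT : 0 < 2)) mulnC; apply: leq_trans kK (card_factor perf c).
have TN a : a \in T -> (a != ord0) && (a != ord_max).
  move=> /(subsetP TC); rewrite inE -!val_eqE /= => /andP[a0 an].
  by rewrite -lt0n a0 ltn_eqF.
have maxN0 : ord_max != ord0 :> 'I_n.+1 by rewrite -val_eqE /= -lt0n.
have TG a : a \in T -> factor s a \subset G.
  move=> aT; have /andP[a0 aM] := TN a aT; apply/subsetP => e ea.
  rewrite inE (card_factor_edge perf ea) eqxx /= /checks.
  case: ifP => [/(factor_inj perf ea) E|_]; first by rewrite E eqxx in a0.
  case: ifP => [/(factor_inj perf ea) E|_]; first by rewrite E eqxx in aM.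
  have -> : T :&: [set a' | e \in factor s a'] = [set a].
    apply/setP => x; rewrite in_setI in_set1 [x \in [set _ | _]]in_set.
    by apply/andP/eqP => [[_ ex]|->]; first exact: factor_inj ex ea.
  by rewrite cards1.
(* Three colours of [T] supply the path and a full class as matching. *)
have [T3|T2] := ltnP 2 #|T|.
  case/card_gt2P: T3 => x [y [z [[xT yT zT] [xy yz zx]]]].
  apply: (@hamiltonian_plus_matching _ s x y z (factor s z)); rewrite ?TG // 1?eq_sym //.
  by apply: leq_trans (cardD z); rewrite leq_pmull.
have selected t : t < K -> odd #|T :&: [set a : 'I_n.+1 | digit a t]| ->
    exists D : graph_on n.+1, [/\ D \subset factor s ord_max, D \subset G & k * 3 < #|D|].
  move=> tK oddT.
  exists [set e in factor s ord_max | index e (enum (factor s ord_max)) %% K == t]; split.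
  - by apply/subsetP => e; rewrite inE => /andP[].
  - apply/subsetP => e; rewrite in_set => /andP[eM /eqP et].
    rewrite in_set (card_factor_edge perf eM) eqxx /= /checks eM et.
    by case: ifP => // /(factor_inj perf eM) E; rewrite E eqxx in maxN0.
  - apply: leq_trans (card_index_class _ tK).
    by rewrite leq_divRL // mulnC.
have lt2K (a : 'I_n.+1) : a < 2 ^ K by apply: leq_ltn_trans nK; rewrite -ltnS.
have singleI a (D : {set 'I_n.+1}) : #|[set a] :&: D| = (a \in D).
  case: (boolP (a \in D)) => aD.
    by rewrite (setIidPl _) ?sub1set // cards1.
  by rewrite disjoint_setI0 ?cards0 // disjoints1.
case T2': #|T| T2 => [|[|[|//]]] _.
- by move/eqP: T2'; rewrite cards_eq0 (negbTE T0).
- have /cards1P[a Ta] : #|T| == 1 by rewrite T2'.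
  have aT : a \in T by rewrite Ta set11.
  have /andP[a0 aM] := TN a aT.
  (* A single colour makes the parity check odd, so colour [0] completes the path; a nonzero digit
     of [a] selects the matching. *)
  have [t tK at0] := digits_neq (lt2K a) (lt2K ord0) a0.
  have [|D [DM DG kD]] := selected t tK.
    by rewrite Ta singleI inE oddb; move: at0; rewrite /digit /= div0n eqbF_neg negbK.
  have G0 : factor s ord0 \subset G.
    apply/subsetP => e e0; rewrite inE (card_factor_edge perf e0) eqxx /= /checks e0.
    by rewrite setIT T2'.
  apply: (@hamiltonian_plus_matching _ s a ord0 ord_max D) => //; by [rewrite eq_sym | exact: TG].
have /cards2P[a [b [ab Tab]]] : #|T| == 2 by rewrite T2'.
have aT : a \in T by rewrite Tab set21.
have bT : b \in T by rewrite Tab set22.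
have /andP[_ aM] := TN a aT; have /andP[_ bM] := TN b bT.
(* A digit where [a] and [b] differ is set in exactly one of them, so its check is odd. *)
have [t tK abt] := digits_neq (lt2K a) (lt2K b) ab.
have [|D [DM DG kD]] := selected t tK.
  rewrite Tab setIUl cardsU !singleI setIACA.
  have -> : [set a] :&: [set b] = set0 by rewrite disjoint_setI0 // disjoints1 inE.
  rewrite set0I cards0 subn0 !inE; move: abt.
  by case: (digit a t); case: (digit b t).
by apply: (@hamiltonian_plus_matching _ s a b ord_max D) => //; by [rewrite eq_sym | exact: TG].
Qed.

(** * Choice of parameters and conclusion *)

Lemma thm_prop_of_perfect_factorization (C V : finType) (s : C -> V -> V) (n : nat) :
  perfect_factorization s -> #|C| = n -> #|V| = n.+1 -> 64 <= n -> thm_prop n.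
Proof.
case: n => // n perf cC cV n64 l l3 lb.
have [||s' perf'] := @perfect_factorization_transport _ _ 'I_n.+1 (option 'I_n.+1) s perf.
- by rewrite card_ord.
- by rewrite card_option card_ord.
have l2 : 2 <= l by exact: ltnW.
have n1 : 1 < n.+1 by apply: leq_trans n64.
have := trunc_log2_bound n1 l2 lb.
set L := trunc_log 2 n.+1 => kL.
have L6 : 6 <= L by apply: trunc_log_max.
have nL : n < 2 ^ L.+1 by apply: ltnW; exact: trunc_log_ltn.
have kK : L.+1 * ((l - 2) * 3).+1 * 2 <= n.
  apply: leq_trans kL; have k1 : 0 < l - 2 by rewrite subn_gt0.
  (* With [k >= 1] and [L >= 6], [(L + 1)(6k + 2) <= 8k(L + 1) <= 12kL]. *)
  by move: (l - 2) k1 => k k1; nia.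
pose C' := [set a : 'I_n.+1 | 0 < a < n].
have cC' : #|C'| = n.+1 - 2.
  have -> : C' = ~: [set ord0; ord_max].
    by apply/setP => a; rewrite !inE -!val_eqE /= negb_or lt0n [a < n]ltn_neqAle -[a <= n]ltnS ltn_ord andbT.
  rewrite cardsCs setCK card_ord cards2 -val_eqE /= eq_sym -lt0n.
  by rewrite -ltnS (leq_trans _ n64).
rewrite -cC'; apply: (linear_code_leq_M (R := checks s' L.+1)) => [|T TC T0].
  by case: (n) n64 => // m _; exact: in_F_set0.
by rewrite -(subnK l2); apply: codeword_graph_in_F.
Qed.

Theorem theorem1p2 :
  (forall N : nat, exists n : nat, N < n /\ 0 < n /\ thm_prop n) /\
  (forall n p : nat, prime p -> odd p -> 64 <= n ->
     (n = p \/ n = (2 * p).-1) -> thm_prop n).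
Proof.
have main n p : prime p -> odd p -> 64 <= n -> n = p \/ n = (2 * p).-1 -> thm_prop n.
  move=> pp po n64 [np|np].
    have [s perf] := perfect_factorization_Fp pp po.
    apply: (thm_prop_of_perfect_factorization perf) => //.
      by rewrite card_Fp.
    by rewrite card_option card_Fp // np.
  have p0 := prime_gt0 pp.
  have n1 : n.+1 = 2 * p by rewrite np prednK // muln_gt0.
  apply: (thm_prop_of_perfect_factorization (perfect_factorization_Fp2 pp po)) => //.
    (* The [p] reflections and [p - 1] nonzero shifts make [2p - 1] colours. *)
    rewrite card_sum card_sig cardC1 card_Fp // np.
    by case: (p) p0 => // q _; rewrite mul2n -addnn addnS.
  by rewrite card_prod card_Fp // card_bool mulnC.
split=> // N.
have [p Np pp] := prime_above (maxn N 64).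
have [Np' p64] : N < p /\ 64 < p by apply/andP; rewrite -gtn_max.
exists p; split=> //; split; first exact: prime_gt0.
apply: (main p p) => //; [|exact: ltnW|by left].
by case: (even_prime pp) p64 => // ->.
Qed.
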